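(* There is an absolute constant $K$ such that the following holds. Let $\Delta\ge3$, $m\ge0$ and $C\ge\Delta^2$ be integers, let $H$ be a $\Delta$-degenerate graph with $\mathsf{v}(H)>C$, and let $\mathcal{B}$ be a $C$-bounded decomposition of $H$ with excess at most $m$. Then $$c(H)\le K\left(\mathsf{v}(H)+m+\frac{\Delta\,\mathsf{v}(H)}{\log(\mathsf{v}(H)/C)}\right).$$
   Context: All graphs are finite and simple. $c(H)$ is the supremum of $\mathsf{e}(G)/\mathsf{v}(G)$ over non-null graphs $G$ with no $H$ minor. A graph is $\Delta$-degenerate if every non-null subgraph has a vertex of degree at most $\Delta$. A decomposition of $H$ is a collection $\mathcal{B}$ of subsets of $V(H)$ such that both ends of every edge lie in some $B\in\mathcal{B}$; it is $C$-bounded if $|B|\le C$ for all $B\in\mathcal{B}$, and its excess is $\sum_{B\in\mathcal{B}}|B|-\mathsf{v}(H)$. *)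

(* Defs.v *)
From HB Require Import structures.
From mathcomp Require Import all_boot all_order all_algebra.

Set Implicit Arguments.
Unset Strict Implicit.
Unset Printing Implicit Defensive.

Import Order.TTheory GRing.Theory Num.Theory.

Local Open Scope ring_scope.

Record sgraph := SGraph {
  vertex :> finType;
  adj : rel vertex;
  adj_sym : symmetric adj;
  adj_irrefl : irreflexive adj
}.

Definition num_vertices (G : sgraph) : nat := #|G|.

Definition edges (G : sgraph) : {set {set G}} :=
  [set [set p.1; p.2] | p : G * G & adj p.1 p.2].

Definition num_edges (G : sgraph) : nat := #|edges G|.

Definition degree (G : sgraph) (x : G) : nat := #|[set y | adj x y]|.

(* Subgraph containment up to isomorphism; the subgraph need not be induced. *)
Definition subgraph (G' G : sgraph) : Prop :=
  exists f : G' -> G, injective f /\ {homo f : x y / adj x y}.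

Definition degenerate (d : nat) (G : sgraph) : Prop :=
  forall G' : sgraph, (0 < num_vertices G')%N -> subgraph G' G ->
    exists x : G', (degree x <= d)%N.

(* The induced subgraph G[S] is connected (in particular non-null). *)
Definition connected_in (G : sgraph) (S : {set G}) : Prop :=
  S != set0 /\
  forall x y : G, x \in S -> y \in S ->
    connect [rel u v | [&& adj u v, u \in S & v \in S]] x y.

(* A model of H in G: [branch x] is the set of vertices contracted to x. *)
Definition has_minor (G H : sgraph) : Prop :=
  exists branch : H -> {set G},
    [/\ forall x, connected_in (branch x),
        forall x y, x != y -> [disjoint branch x & branch y] &
        forall x y, adj x y ->
          exists u v, [/\ u \in branch x, v \in branch y & adj u v]].

Definition decomposition (H : sgraph) (BB : {set {set H}}) : Prop :=
  forall x y : H, adj x y -> exists2 B, B \in BB & (x \in B) && (y \in B).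

Definition bounded_decomposition (C : nat) (H : sgraph) (BB : {set {set H}}) :
    Prop :=
  decomposition BB /\ forall B, B \in BB -> (#|B| <= C)%N.

(* Integer-valued: it is negative when enough isolated vertices of H are left
   uncovered. *)
Definition excess (H : sgraph) (BB : {set {set H}}) : int :=
  (\sum_(B in BB) #|B|)%N%:Z - (num_vertices H)%:Z.

(* Imported only here, as it shadows the finite-set names set0, setT, etc. *)
From mathcomp Require Import all_classical all_reals all_analysis.

Local Open Scope classical_set_scope.

(* The supremum is taken in \bar R, so that an upper bound on it also asserts
   that the densities are bounded. *)
Definition minor_density (R : realType) (H : sgraph) : \bar R :=
  ereal_sup [set r : \bar R | exists G : sgraph,
    [/\ (0 < num_vertices G)%N, ~ has_minor G H &
        r = ((num_edges G)%:R / (num_vertices G)%:R)%:E]].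

(* Main.v *)
Require Import Defs.
From HB Require Import structures.
From mathcomp Require Import all_boot all_order all_algebra.
From mathcomp Require Import zify ring lra.

(** Let v be the number of vertices of H, and let r be about log(v/C)/3.

    Contracting edges as long as the density does not drop, and then taking the
    neighbourhood of a vertex of minimum degree, yields a minor on n vertices,
    with n at least the density of G, in which every vertex is adjacent to
    about half of the others.  Some neighbourhood in it contains a set W of at
    least n/4 vertices any two of which are joined by so many paths with three
    inner vertices that linking two of them always costs at most three unused
    vertices.

    Orient H with out-degrees at most Delta and assign each edge to a part of
    the decomposition containing it.  Every vertex x of H gets a hub in W.  The
    parts B are treated one by one: each x in B receives a vertex a_x, chosen
    at random in W intersected with the neighbourhood of a suitable vertex w.
    By dependent random choice, r + 1 vertices chosen in this way have few
    common neighbours with probability O(4^r C (2 + Delta/r) / n), which is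
    O(1/r).  Cut the edges leaving x inside B into chunks of r edges; a common
    neighbour b of a_x and of the vertices a_y of a chunk, added to the branch
    set of x, realizes all the edges of the chunk at once.  The few failed
    chunks are replaced by individual links between hubs, and each a_x is linked
    to the hub of x.  Altogether this uses O(v + m + Delta v / r) vertices. *)

Set Implicit Arguments.
Unset Strict Implicit.
Unset Printing Implicit Defensive.

(** * Minors *)

(** The relation inside [connected_in], named so that walks can be carried from a set to a larger
    one. *)
Definition inner_adj (G : sgraph) (S : {set G}) : rel G :=
  [rel u v | [&& adj u v, u \in S & v \in S]].

Lemma inner_connect_sym (G : sgraph) (S : {set G}) : connect_sym (inner_adj S).
Proof.
by apply: sym_connect_sym => x y; rewrite /inner_adj /= adj_sym [(x \in S) && _]andbC.
Qed.

Lemma inner_connect_sub (G : sgraph) (S S' : {set G}) (x y : G) :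
  S \subset S' -> connect (inner_adj S) x y -> connect (inner_adj S') x y.
Proof.
move=> sSS'; apply: connect_sub => u v /and3P[uv uS vS]; apply: connect1.
by rewrite /inner_adj /= uv !(subsetP sSS').
Qed.

Lemma inner_connect1 (G : sgraph) (S : {set G}) (x y : G) :
  adj x y -> x \in S -> y \in S -> connect (inner_adj S) x y.
Proof. by move=> xy xS yS; apply: connect1; rewrite /inner_adj /= xy xS yS. Qed.

(** Two points of [S'] are joined by walking to [S], moving inside it and walking back. When a
    branch set grows, only the new vertices need a walk to the old set. *)
Lemma connected_extend (G : sgraph) (S S' : {set G}) :
    connected_in S -> S \subset S' ->
    (forall x, x \in S' -> exists2 s, s \in S & connect (inner_adj S') s x) ->
  connected_in S'.
Proof.
move=> [/set0Pn[s0 s0S] conS] sSS' conS'; split.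
  by apply/set0Pn; exists s0; rewrite (subsetP sSS').
move=> x y /conS'[s sS sx] /conS'[t tS ty].
apply: (connect_trans _ ty); apply: (connect_trans (y := s)).
  by rewrite [connect _ _ _]inner_connect_sym.
exact/(inner_connect_sub sSS')/conS.
Qed.

Lemma connected_set1 (G : sgraph) (x : G) : connected_in [set x].
Proof.
split; first by apply/set0Pn; exists x; rewrite set11.
by move=> y z /set1P-> /set1P->.
Qed.

Lemma connected_set2 (G : sgraph) (x y : G) : adj x y -> connected_in [set x; y].
Proof.
move=> xy; apply: (connected_extend (connected_set1 x)) => [|z].
  by rewrite sub1set set21.
by case/set2P=> ->; exists x; rewrite ?set11 // inner_connect1 ?set21 ?set22.
Qed.

Lemma has_minor_trans (G G1 H : sgraph) :
  has_minor G G1 -> has_minor G1 H -> has_minor G H.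
Proof.
move=> [f [f_con f_disj f_adj]] [g [g_con g_disj g_adj]].
exists (fun x => \bigcup_(z in g x) f z); split=> [x|x y xy|x y /g_adj[z [t [zx ty zt]]]].
- have [/set0Pn[z0 z0x] conx] := g_con x.
  apply: (connected_extend (f_con z0)); first exact: bigcup_sup.
  set S' := \bigcup_(z in g x) f z.
  have f_sub z : z \in g x -> f z \subset S' by move=> zx; apply: bigcup_sup.
  (* Induction along a path of [g x]: move inside the connected set [f z], then cross into the next
     one by an edge that [f_adj] provides. *)
  have step z t : z \in g x -> t \in g x -> connect (inner_adj (g x)) z t ->
      forall u, u \in f z -> forall w, w \in f t -> connect (inner_adj S') u w.
    move=> zx tx /connectP[p]; elim: p z zx => [|z1 p IHp] z zx /=.
      move=> _ -> u uz w wz; apply: (inner_connect_sub (f_sub z zx)).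
      exact: (f_con z).2.
    case/andP=> /and3P[zz1 _ z1x] pth tE u uz w wt.
    have [u1 [w1 [u1z w1z1 uw1]]] := f_adj _ _ zz1.
    apply: connect_trans (IHp z1 z1x pth tE w1 w1z1 w wt).
    apply: (connect_trans (y := u1)).
      by apply: (inner_connect_sub (f_sub z zx)); apply: (f_con z).2.
    exact: inner_connect1 uw1 (subsetP (f_sub z zx) _ u1z) (subsetP (f_sub z1 z1x) _ w1z1).
  move=> u /bigcupP[t tx ut]; have /set0Pn[u0 u0z0] := (f_con z0).1.
  by exists u0 => //; apply: (step z0 t) => //; apply: conx.
- apply/pred0P => u /=; apply/negbTE/negP=> /andP[/bigcupP[z zx uz] /bigcupP[t ty ut]].
  have [ztE|zt] := eqVneq z t.
    by have := disjointFr (g_disj _ _ xy) zx; rewrite ztE ty.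
  by have := disjointFr (f_disj _ _ zt) uz; rewrite ut.
- have [u [w [uz wt uw]]] := f_adj _ _ zt.
  by exists u, w; split=> //; apply/bigcupP; [exists z|exists t].
Qed.

Lemma subgraph_minor (G G' : sgraph) : subgraph G' G -> has_minor G G'.
Proof.
move=> [f [f_inj f_adj]]; exists (fun x => [set f x]); split=> [x|x y xy|x y xy].
- exact: connected_set1.
- by rewrite disjoints1 inE (inj_eq f_inj) .
- by exists (f x), (f y); rewrite !set11 f_adj.
Qed.

Section Induced.
Variables (G : sgraph) (S : {set G}).

Definition induced_adj : rel {x : G | x \in S} := [rel x y | adj (val x) (val y)].

Lemma induced_adj_sym : symmetric induced_adj.
Proof. by move=> x y; rewrite /induced_adj /= adj_sym. Qed.

Lemma induced_adj_irrefl : irreflexive induced_adj.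
Proof. by move=> x; rewrite /induced_adj /= adj_irrefl. Qed.

Definition induced : sgraph := SGraph induced_adj_sym induced_adj_irrefl.

Lemma induced_subgraph : subgraph induced G.
Proof. by exists (fun x : induced => val x); split=> //; exact: val_inj. Qed.

Lemma card_induced : #|induced| = #|S|.
Proof. by rewrite card_sig; apply: eq_card => x; rewrite !inE. Qed.

Lemma card_val_induced (P : pred G) :
  #|[set y : induced | P (val y)]| = #|[set y in S | P y]|.
Proof.
rewrite -(card_imset (f := fun y : induced => val y)); last exact: val_inj.
apply: eq_card => y; apply/imsetP/idP => [[z]|]; rewrite !inE.
  by move=> Pz ->; rewrite Pz (valP z).
by case/andP=> yS Py; exists (exist _ y yS); rewrite ?inE.
Qed.

Lemma degree_induced (x : induced) :
  degree x = #|[set y in S | adj (val x) y]|.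
Proof. by rewrite -card_val_induced; apply: eq_card => y; rewrite !inE. Qed.

End Induced.

(** Vertices of small degree are peeled off one by one; the edges from the peeled vertex to the rest
    of [S] are oriented out of it. *)
Lemma degenerate_orientation (d : nat) (H : sgraph) :
    degenerate d H ->
  exists back : H -> {set H}, (forall x, #|back x| <= d) /\
    (forall x y, adj x y -> y \in back x \/ x \in back y).
Proof.
move=> degH.
suff orient n (S : {set H}) : #|S| <= n ->
    exists back : H -> {set H}, (forall x, #|back x| <= d) /\
      {in S &, forall x y, adj x y -> y \in back x \/ x \in back y}.
  have [back [le_d cov]] := orient _ [set: H] (leqnn _).
  by exists back; split=> // x y; apply: cov; rewrite inE.
elim: n S => [|n IHn] S leSn.
  exists (fun=> set0); split=> [x|x y]; first by rewrite cards0.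
  by move: leSn; rewrite leqn0 cards_eq0 => /eqP->; rewrite inE.
have [S0|/set0Pn[x0 x0S]] := eqVneq S set0.
  by apply: IHn; rewrite S0 cards0.
have [|x le_deg] := degH (induced S) _ (induced_subgraph S).
  by rewrite /num_vertices card_induced card_gt0; apply/set0Pn; exists x0.
have [|back [le_d cov]] := IHn (S :\ val x).
  by move: leSn; rewrite (cardsD1 (val x)) (valP x).
exists (fun y => if y == val x then [set z in S | adj (val x) z] else back y).
split=> [y|y z yS zS yz].
  by case: ifP => // _; rewrite -degree_induced.
have [yE|yx] := eqVneq y (val x); first by left; rewrite inE zS -yE.
have [zE|zx] := eqVneq z (val x); first by right; rewrite inE yS -zE adj_sym.
by apply: cov; rewrite ?inE ?yx ?zx.
Qed.

(** * A dense minor *)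

Lemma sum_degreeE (G : sgraph) :
  \sum_(x : G) degree x = #|[set p : G * G | adj p.1 p.2]|.
Proof.
under eq_bigr => x _ do rewrite /degree -sum1_card.
rewrite -sum1_card pair_big_dep /=.
by apply: eq_bigl => p; rewrite !inE.
Qed.

Lemma num_edges_sum_degree (G : sgraph) :
  2 * num_edges G <= \sum_(x : G) degree x.
Proof.
rewrite sum_degreeE -sum1_card.
rewrite (partition_big (fun p : G * G => [set p.1; p.2]) (mem (edges G))) /=; last first.
  by move=> p; rewrite inE => pE; apply/imsetP; exists p; rewrite ?inE.
rewrite /num_edges mulnC -sum_nat_const; apply: leq_sum => e /imsetP[[x y]].
rewrite inE /= => xy ->; rewrite sum1dep_card.
have xNy : (x, y) != (y, x).
  by apply/eqP => -[xE _]; rewrite xE adj_irrefl in xy.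
rewrite -[2]/((true : nat).+1) -xNy -cards2; apply/subset_leq_card/subsetP => p.
by case/set2P=> ->; rewrite !inE /= ?xy ?eqxx // adj_sym xy setUC eqxx.
Qed.

Section Contraction.
Variables (G : sgraph) (a b : G).

(** The merged vertex keeps the name [a] and [b] disappears. The guard [val x != val y] removes the
    loop that the edge [ab] would leave at [a]. *)
Definition contract_adj : rel {x : G | x != b} :=
  [rel x y | (val x != val y) && [|| adj (val x) (val y),
     (val x == a) && adj b (val y) | (val y == a) && adj b (val x)]].

Lemma contract_adj_sym : symmetric contract_adj.
Proof.
move=> x y; rewrite /contract_adj /= eq_sym adj_sym.
by congr (_ && (_ || _)); rewrite orbC.
Qed.

Lemma contract_adj_irrefl : irreflexive contract_adj.
Proof. by move=> x; rewrite /contract_adj /= eqxx. Qed.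

Definition contract : sgraph := SGraph contract_adj_sym contract_adj_irrefl.

Hypothesis ab : adj a b.

Lemma contract_minor : has_minor G contract.
Proof.
have ba : adj b a by rewrite adj_sym.
have aNb : a != b by apply/eqP => abE; move: ab; rewrite abE adj_irrefl.
exists (fun x : contract => if val x == a then [set a; b] else [set val x]).
split=> [x|x y xy|x y /andP[_] /or3P[]].
- by case: ifP => _; [exact: connected_set2|exact: connected_set1].
- have xy' : val x != val y by rewrite (inj_eq val_inj).
  have := valP (x : {x | x != b}); have := valP (y : {x | x != b}).
  rewrite /= => /negbTE yb /negbTE xb.
  case: (eqVneq (val x) a) => [xa|xa]; case: (eqVneq (val y) a) => [ya|ya].
  + by rewrite xa ya eqxx in xy'.
  + by rewrite disjoint_sym disjoints1 !inE negb_or ya yb.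
  + by rewrite disjoints1 !inE negb_or xa xb.
  + by rewrite disjoints1 inE.
- move=> xy; exists (val x), (val y); split=> //.
    by case: (eqVneq (val x) a) => [->|_]; rewrite !inE eqxx.
  by case: (eqVneq (val y) a) => [->|_]; rewrite !inE eqxx.
- case/andP=> xa by_; exists b, (val y); rewrite xa set22; split=> //.
  by case: (eqVneq (val y) a) => [->|_]; rewrite !inE eqxx.
- case/andP=> ya bx; exists (val x), b; rewrite ya set22 adj_sym; split=> //.
  by case: (eqVneq (val x) a) => [->|_]; rewrite !inE eqxx.
Qed.

Lemma card_contract : #|contract|.+1 = #|G|.
Proof.
rewrite -[#|G|]cardsT (cardsD1 b) inE card_sig add1n; congr _.+1.
by apply: eq_card => x; rewrite !inE andbT.
Qed.

(** Contraction destroys the edge [ab] and, for each common neighbour, merges two edges into one;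
    each lost edge counts twice in the degree sum. *)
Lemma sum_degree_contract :
  \sum_(x : G) degree x <=
    \sum_(x : contract) degree x + 2 * (#|[set y | adj a y & adj b y]|).+1.
Proof.
have ba : adj b a by rewrite adj_sym.
have aNb : a != b by apply/eqP => abE; move: ab; rewrite abE adj_irrefl.
(* Ordered pairs in [P0] avoid [b] and survive. Each [y] in [S] is a new neighbour of [a] and
   contributes the pairs [(a, y)] and [(y, a)]. *)
set c := #|_|; pose S := [set y | adj b y && ~~ adj a y && (y != a)].
pose P0 := [set p : G * G | [&& adj p.1 p.2, p.1 != b & p.2 != b]].
have degb : degree b <= #|S| + c.+1.
  rewrite /degree -(cardsID [set y | adj a y]).
  have -> : [set y | adj b y] :&: [set y | adj a y] = [set y | adj a y & adj b y].
    by apply/setP => y; rewrite !inE andbC.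
  rewrite -/c addnC addnS -addSn leq_add2r (cardsD1 a) -add1n.
  apply: leq_add; first by case: (_ \in _).
  by apply/subset_leq_card/subsetP => y; rewrite !inE; case: eqP; case: adj; case: adj.
have eG : \sum_(x : G) degree x <= #|P0| + 2 * degree b.
  rewrite sum_degreeE mul2n -addnn.
  have -> : degree b = #|[set (b, y) | y in [set y | adj b y]]|.
    by rewrite card_imset // => y z [].
  have {2}-> : #|[set (b, y) | y in [set y | adj b y]]| =
      #|[set (y, b) | y in [set y | adj b y]]|.
    by rewrite !card_imset // => y z [].
  apply: leq_trans (leq_trans (leq_card_setU P0 _) (leq_add (leqnn _) (leq_card_setU _ _))).
  apply/subset_leq_card/subsetP => -[x y]; rewrite !inE /= => xy; rewrite xy /=.
  case: (eqVneq x b) => [xb|xb] /=.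
    apply/orP; left; apply/imsetP; exists y; rewrite ?inE -?xb //.
  case: (eqVneq y b) => [yb|yb] //=.
  apply/orP; right; apply/imsetP; exists x; last by rewrite yb.
  by rewrite inE -yb adj_sym.
have eC : #|P0| + 2 * #|S| <= \sum_(x : contract) degree x.
  rewrite sum_degreeE.
  rewrite -(card_imset (f := fun p : contract * contract =>
    (val p.1, val p.2))); last first.
    by move=> [x y] [x' y'] /= [] /val_inj-> /val_inj->.
  have SX1 : #|[set (a, y) | y in S]| = #|S| by rewrite card_imset // => y z [].
  have SX2 : #|[set (y, a) | y in S]| = #|S| by rewrite card_imset // => y z [].
  have cardU (A B : {set G * G}) : [disjoint A & B] -> #|A :|: B| = #|A| + #|B|.
    by move=> dAB; apply/eqP; rewrite (leq_card_setU A B).2.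
  rewrite mul2n -addnn -{1}SX1 -SX2 addnA -!cardU.
  - apply/subset_leq_card/subsetP => p; rewrite !inE -orbA => pE.
    have {pE} [p1b p2b pE] : [/\ p.1 != b, p.2 != b & (p.1 != p.2) &&
        [|| adj p.1 p.2, (p.1 == a) && adj b p.2 | (p.2 == a) && adj b p.1]].
      case/or3P: pE.
      + case/and3P=> xy -> ->; rewrite xy; split=> //.
        by case: eqP xy => // ->; rewrite adj_irrefl.
      + case/imsetP=> y; rewrite inE => /andP[/andP[by_ ay] ya] -> /=.
        rewrite eqxx by_ /= orbT andbT; split=> //; last by rewrite eq_sym.
        by apply/eqP => yb; rewrite yb adj_irrefl in by_.
      + case/imsetP=> y; rewrite inE => /andP[/andP[by_ ay] ya] -> /=.
        rewrite eqxx by_ /= !orbT andbT; split=> //.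
        by apply/eqP => yb; rewrite yb adj_irrefl in by_.
    apply/imsetP; exists (exist _ p.1 p1b, exist _ p.2 p2b); last exact: surjective_pairing.
    by rewrite inE /= /contract_adj.
  - apply/pred0P => p /=; apply/negbTE/andP => -[/setUP[]]; last first.
      case/imsetP=> y; rewrite inE => /andP[_ ya] -> /imsetP[z]; rewrite inE.
      by move=> /andP[_ za] [az ya']; rewrite ya' eqxx in ya.
    rewrite inE => /and3P[pa _ _] /imsetP[y]; rewrite inE => /andP[/andP[_ ay] _] pE.
    by move: pa; rewrite pE /= adj_sym (negbTE ay).
  - apply/pred0P => p /=; apply/negbTE/andP => -[].
    rewrite inE => /and3P[pa _ _] /imsetP[y]; rewrite inE => /andP[/andP[_ ay] _] pE.
    by move: pa; rewrite pE /= (negbTE ay).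
apply: leq_trans eG _; apply: leq_trans (leq_add eC (leqnn _)).
by rewrite -addnA leq_add2l -mulnDr leq_mul2l degb.
Qed.

End Contraction.

(** Induction on the order of [G], deleting isolated vertices and contracting edges. When neither is
    possible, each neighbour of a vertex [x] of least degree shares with it more than half the
    average degree minus one. As [degree x] is at most the average, the neighbourhood of [x] is the
    required minor. *)
Lemma dense_neighborhood_minor (G : sgraph) (D : nat) :
    0 < #|G| -> 0 < D -> 2 * D * #|G| <= \sum_(x : G) degree x ->
  exists G1 : sgraph, [/\ has_minor G G1, D <= #|G1| &
    forall y : G1, #|G1| <= 2 * degree y + 1].
Proof.
move=> + D_gt0.
have [N] := ubnP #|G|; elim: N G => // N IHN G leGN G_gt0 dense.
(* The vertex of least degree must have a neighbour, since its degree is bounded below through a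
   common neighbourhood. *)
have [/existsP[b /eqP deg_b]|/existsPn no_isolated] :=
  boolP [exists b : G, degree b == 0].
  have adj_b y : adj b y = false.
    by apply/negbTE/negP => by_; have := card0_eq deg_b y; rewrite !inE by_.
  have cardI : #|induced [set~ b]| = #|G|.-1 by rewrite card_induced cardsC1.
  have sumI : \sum_(x : G) degree x <= \sum_(x : induced [set~ b]) degree x.
    rewrite !sum_degreeE.
    rewrite -(card_imset (f := fun p : induced [set~ b] * induced [set~ b] =>
      (val p.1, val p.2))); last by move=> [x y] [x' y'] /= [] /val_inj-> /val_inj->.
    apply/subset_leq_card/subsetP => -[x y]; rewrite inE /= => xy.
    have xb : x \in [set~ b].
      by rewrite !inE; apply: contraTneq xy => ->; rewrite adj_b.
    have yb : y \in [set~ b].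
      by rewrite !inE; apply: contraTneq xy => ->; rewrite adj_sym adj_b.
    by apply/imsetP; exists (exist _ x xb, exist _ y yb); rewrite ?inE.
  have G_gt1 : 1 < #|G|.
    rewrite ltnNge; apply/negP => G_le1; move: dense; rewrite (bigD1 b) //=.
    rewrite deg_b big1 => [|x xb]; first by rewrite addn0 leqNgt !muln_gt0 D_gt0 G_gt0.
    have := leq_trans (max_card [set b; x]) G_le1.
    by rewrite cards2 eq_sym xb.
  have [||| G1 [min1 le1 deg1]] := IHN (induced [set~ b]).
  - by rewrite cardI; lia.
  - by rewrite cardI; lia.
  - by apply: leq_trans sumI; apply: leq_trans dense; rewrite cardI leq_mul2l leq_pred orbT.
  exists G1; split=> //; apply: has_minor_trans min1.
  exact/subgraph_minor/induced_subgraph.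
pose common (a b : G) := #|[set y | adj a y & adj b y]|.
(* Contracting an edge whose ends have few common neighbours does not lower the
   density. *)
have [/existsP[a /existsP[b /andP[ab small]]]|/existsPn big] := boolP [exists a : G,
    exists b : G, adj a b && (2 * (common a b).+1 * #|G| <= \sum_(x : G) degree x)].
  have G_gt1 : 1 < #|G|.
    apply: leq_trans (max_card [set a; b]); rewrite cards2.
    by case: eqP ab => // ->; rewrite adj_irrefl.
  have cardK := card_contract a b.
  have := sum_degree_contract ab; rewrite -/(common a b) => sumK.
  have [||| G1 [min1 le1 deg1]] := IHN (contract a b).
  - by lia.
  - by lia.
  - rewrite -(leq_pmul2r G_gt0); move: small sumK dense; rewrite -cardK; nia.
  by exists G1; split=> //; apply: has_minor_trans min1; apply: contract_minor.
have /card_gt0P[x0 _] := G_gt0.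
have [x _ min_x] := arg_minnP (fun x : G => degree x) (isT : predT x0).
have deg_x : degree x * #|G| <= \sum_(x : G) degree x.
  by rewrite mulnC -sum_nat_const; apply: leq_sum => y _; apply: min_x.
have {}big y : adj x y -> \sum_(x : G) degree x < 2 * (common x y).+1 * #|G|.
  by move=> xy; have /existsPn/(_ y) := big x; rewrite xy /= ltnNge.
exists (induced [set y | adj x y]); rewrite card_induced -/(degree x); split.
- exact/subgraph_minor/induced_subgraph.
- have [y] : exists y : G, y \in [set y | adj x y].
    by apply/set0Pn; rewrite -card_gt0 lt0n; apply: no_isolated.
  rewrite inE => xy; have := big y xy.
  have : common x y <= degree x.
    by apply/subset_leq_card/subsetP => z; rewrite !inE => /andP[].
  by nia.
- move=> y; have xy : adj x (val y) by have := valP (y : {y | y \in _}); rewrite inE.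
  have := big _ xy; rewrite degree_induced.
  have -> : #|[set z in [set y | adj x y] | adj (val y) z]| = common x (val y).
    by apply: eq_card => z; rewrite !inE.
  by nia.
Qed.

(** * Linking *)

Lemma card_bigcup_le (I V : finType) (P : pred I) (F : I -> {set V}) :
  #|\bigcup_(i | P i) F i| <= \sum_(i | P i) #|F i|.
Proof.
elim/big_rec2: _ => [|i k S _ le_S]; first by rewrite cards0.
by apply: leq_trans (leq_card_setU _ _).1 _; rewrite leq_add2l.
Qed.

(** Greedy choice: each new set avoids [Fb] and all earlier sets, whose total size stays within the
    budget [b]. *)
Lemma disjoint_choice (I V : finType) (P : I -> {set V} -> Prop) (k b : nat)
    (J : {set I}) (Fb : {set V}) :
    (forall i (Fb' : {set V}), i \in J -> #|Fb'| <= b ->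
      exists X : {set V}, [/\ [disjoint X & Fb'], #|X| <= k & P i X]) ->
    #|Fb| + k * #|J| <= b ->
  exists X : I -> {set V},
    (forall i, i \in J -> [/\ [disjoint X i & Fb], #|X i| <= k & P i (X i)]) /\
    {in J &, forall i j, i != j -> [disjoint X i & X j]}.
Proof.
have [N] := ubnP #|J|; elim: N J Fb => // N IHN J Fb leJN choice leFb.
have [J0|/set0Pn[i iJ]] := eqVneq J set0.
  by exists (fun=> set0); split=> [i|i j]; rewrite J0 inE.
have cardJ : #|J| = #|J :\ i|.+1 by rewrite (cardsD1 i) iJ.
have [|X0 [X0_disj leX0 PX0]] := choice i Fb iJ; first by lia.
have [|||X [X_ok X_disj]] := IHN (J :\ i) (Fb :|: X0).
- by rewrite -ltnS -cardJ.
- move=> j Fb' /setD1P[_ jJ]; exact: choice.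
- by have := leq_card_setU Fb X0 => -[]; nia.
exists (fun j => if j == i then X0 else X j); split=> [j jJ|j l jJ lJ].
  have [->|ji] := eqVneq j i; first by [].
  have [|djU leXj PXj] := X_ok j; first by rewrite !inE ji.
  split=> //; apply: disjointWr djU; exact: subsetUl.
have [jE|ji] := eqVneq j i; have [lE|li] := eqVneq l i; rewrite ?jE ?lE ?eqxx //.
- have [|djU _ _] := X_ok l; first by rewrite !inE li.
  by move=> _; rewrite disjoint_sym; apply: disjointWr djU; apply: subsetUr.
- have [|djU _ _] := X_ok j; first by rewrite !inE ji.
  by move=> _; apply: disjointWr djU; apply: subsetUr.
- by apply: X_disj; rewrite !inE ?ji ?li.
Qed.

(** Greedy choice suffices, as every candidate set has at least as many elements as there are
    indices; [v0] is only a value outside [J]. *)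
Lemma distinct_representatives (I V : finType) (v0 : V) (J : {set I})
    (cand : I -> {set V}) :
    (forall i, i \in J -> #|J| <= #|cand i|) ->
  exists g : I -> V, (forall i, i \in J -> g i \in cand i) /\ {in J &, injective g}.
Proof.
have [N] := ubnP #|J|; elim: N J => // N IHN J leJN big.
have [J0|/set0Pn[i iJ]] := eqVneq J set0.
  by exists (fun=> v0); split=> [i|i j]; rewrite J0 inE.
have cardJ : #|J| = #|J :\ i|.+1 by rewrite (cardsD1 i) iJ.
have [| |g [g_cand g_inj]] := IHN (J :\ i).
- by rewrite -ltnS -cardJ.
- by move=> j /setD1P[_ jJ]; apply: leq_trans (big j jJ); rewrite cardJ.
have [v vi vg] : exists2 v, v \in cand i & v \notin g @: (J :\ i).
  apply/subsetPn/negP => /subset_leq_card; apply/negP; rewrite -ltnNge.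
  by apply: leq_ltn_trans (leq_imset_card _ _) _; rewrite -cardJ; apply: big.
have vgj j : j \in J -> j != i -> v = g j -> False.
  by move=> jJ ji vE; case/imsetP: vg; exists j; rewrite // !inE ji.
exists (fun j => if j == i then v else g j); split=> [j jJ|j l jJ lJ].
  by have [->|ji] := eqVneq j i; rewrite ?g_cand // !inE ji.
have [jE|ji] := eqVneq j i; have [lE|li] := eqVneq l i; rewrite ?jE ?lE ?eqxx //.
- by move/(vgj l lJ li).
- by move/esym/(vgj j jJ ji).
- by apply: g_inj; rewrite !inE ?ji ?li.
Qed.

Section Linking.
Variable G : sgraph.
Hypothesis G_gt0 : 0 < #|G|.
Hypothesis dense : forall y : G, #|G| <= 3 * degree y.

(** The forbidden set is arbitrary up to a fixed fraction of the graph, so that links can be built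
    one after another, each avoiding all vertices in use. *)
Definition linked (W : {set G}) := forall (u v : G) (Fb : {set G}),
  u \in W -> v \in W -> 200 * #|Fb| <= #|G| ->
  exists x z y : G, [/\ x \notin Fb, z \notin Fb, y \notin Fb &
    [/\ adj u x, adj x z, adj z y & adj y v]].

(* Two random neighbours of a random vertex rarely have few common neighbours,
   so some neighbourhood contains few pairs that do. *)
Lemma exists_linked_set : exists W : {set G}, #|G| <= 4 * #|W| /\ linked W.
Proof.
set n := #|G|; have n_gt0 : 0 < n := G_gt0.
pose common (u v : G) := #|[set y | adj u y & adj v y]|.
pose bad (u v : G) := 144 * common u v < n.
pose cnt w := \sum_(u | adj w u) #|[set z | adj w z & bad u z]|.
(* Averaging over [w]: a bad pair has fewer than n/144 common neighbours, hence lies in fewer than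
   n/144 neighbourhoods. *)
have [w cnt_w] : exists w, 144 * cnt w <= n ^ 2.
  apply/existsP; rewrite -[[exists _, _]]negbK; apply/negP => /existsPn no_w.
  have : \sum_(w : G) n ^ 2 < \sum_(w : G) 144 * cnt w.
    have /card_gt0P[w0 _] := G_gt0.
    rewrite (bigD1 w0) // [X in _ < X](bigD1 w0) //= -addSn; apply: leq_add.
      by rewrite ltnNge no_w.
    by apply: leq_sum => w _; rewrite ltnW // ltnNge no_w.
  rewrite sum_nat_const -/n; apply/negP; rewrite -leqNgt -big_distrr /=.
  have -> : \sum_w cnt w = \sum_(u : G) \sum_(z : G | bad u z) common u z.
    rewrite /cnt (exchange_big_dep predT) //=; apply: eq_bigr => u _.
    under eq_bigr => w _ do rewrite -sum1dep_card.
    rewrite (exchange_big_dep [pred z | bad u z]) /=; last by move=> ? z _ /andP[].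
    apply: eq_bigr => z uz; rewrite sum1dep_card; apply: eq_card => w.
    by rewrite !inE uz andbT !(adj_sym w).
  rewrite big_distrr /= expnSr expn1 -{2}[n]/#|G| -sum_nat_const.
  apply: leq_sum => u _; rewrite big_distrr /= -{1}[n]/#|G| -sum_nat_const.
  rewrite [X in _ <= X](bigID (fun z => bad u z)) /=.
  by apply: leq_trans (leq_addr _ _); apply: leq_sum => z; apply: ltnW.
pose A := [set u | adj w u].
pose B u := [set z | adj w z & bad u z].
(* Vertices with more than n/12 bad partners are dropped. By [cnt_w] there are at most n/12 of them,
   which leaves n/3 - n/12 = n/4. *)
pose W := [set u in A | 12 * #|B u| <= n].
have AW : 12 * #|A :\: W| <= n.
  have : #|A :\: W| * n <= 12 * cnt w.
    rewrite -sum_nat_const /cnt big_distrr /=.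
    apply: (@leq_trans (\sum_(u in A :\: W) 12 * #|B u|)).
      apply: leq_sum => u; rewrite !inE => /andP[+ wu].
      by rewrite wu /= -ltnNge => /ltnW.
    rewrite [X in _ <= X](bigID (fun u => u \in W)) /= addnC.
    rewrite (eq_bigl (fun u => adj w u && (u \notin W))) ?leq_addr // => u.
    by rewrite !inE andbC.
  by move: cnt_w; rewrite expnS expn1; nia.
have cardA := dense w; rewrite /degree -/A -/n in cardA.
exists W; split.
  have := cardsID W A; have : #|A :&: W| <= #|W|.
    by apply/subset_leq_card/subsetIr.
  by rewrite -/n; lia.
move=> u v Fb; rewrite !inE => /andP[wu Bu] /andP[wv Bv]; rewrite -/n => leFb.
(* The middle vertex forms a good pair with both ends; it exists because n/12 + n/12 + n/200 < n/3.
   Then n/200 < n/144 leaves a free common neighbour on either side. *)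
have [z zA zU] : exists2 z, z \in A & z \notin B u :|: B v :|: Fb.
  apply/subsetPn/negP => /subset_leq_card.
  have [+ _] := leq_card_setU (B u :|: B v) Fb.
  have [+ _] := leq_card_setU (B u) (B v).
  by lia.
move: zU zA; rewrite !inE !negb_or => /andP[/andP[zu zv] zFb] wz.
rewrite wz /bad -leqNgt in zu; rewrite wz /bad -leqNgt in zv.
have pick_common t : n <= 144 * common t z ->
    exists2 x, x \notin Fb & adj t x && adj x z.
  move=> le_t; have [x] : exists2 x, x \in [set y | adj t y & adj z y] & x \notin Fb.
    apply/subsetPn/negP => /subset_leq_card; rewrite -/(common t z); lia.
  by rewrite inE (adj_sym z) => tx xFb; exists x.
have [x xFb /andP[ux xz]] := pick_common u zu.
have [y yFb /andP[vy yz]] := pick_common v zv.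
by exists x, z, y; split=> //; split; rewrite // adj_sym.
Qed.

End Linking.

(** * Dependent random choice *)

(** Cross-multiplied equality of probabilities: an event that depends on the coordinates in [c] only
    may be computed on [c]. Functions on [c] are encoded as total functions with value [x0]
    elsewhere. *)
Lemma card_ffun_on_restrict (T V : finType) (x0 : V) (c : {set T}) (U : {set V})
    (P : pred {ffun T -> V}) :
    (forall f g : {ffun T -> V}, {in c, f =1 g} -> P f = P g) ->
  #|[set f in ffun_on U | P f]| * #|U| ^ #|c| =
  #|[set g in pffun_on x0 c U | P g]| * #|U| ^ #|T|.
Proof.
move=> P_dep; pose restr (f : {ffun T -> V}) := [ffun x => if x \in c then f x else x0].
(* Fibres of the restriction map: the values outside [c] are free. *)
have -> : #|[set f in ffun_on U | P f]| =
    #|[set g in pffun_on x0 c U | P g]| * #|U| ^ #|~: c|.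
  rewrite -sum1_card (partition_big restr (mem [set g in pffun_on x0 c U | P g])) /=.
    rewrite -sum_nat_const; apply: eq_bigr => g.
    rewrite inE => /andP[/pffun_onP[g_supp gU] Pg].
    rewrite sum1dep_card.
    pose F x := if x \in c then pred1 (g x) else [pred y in U].
    have -> : #|[set f in [set f in ffun_on U | P f] | restr f == g]| = #|family F|.
      apply: eq_card => f; rewrite !inE; apply/idP/familyP.
        case/andP=> /andP[/ffun_onP fU _] /eqP fg x; rewrite /F.
        by case: ifP => xc; rewrite inE ?fU // -fg ffunE xc eqxx.
      move=> f_fam; have fg : {in c, f =1 g}.
        by move=> x xc; have := f_fam x; rewrite /F xc inE => /eqP.
      rewrite (P_dep _ _ fg) Pg andbT; apply/andP; split.
        apply/ffun_onP => x; have := f_fam x; rewrite /F; case: ifP => //= xc.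
        by rewrite inE => /eqP->; apply: gU; apply/imageP; exists x.
      apply/eqP/ffunP => x; rewrite ffunE; case: ifP => xc; first exact: fg.
      by apply/eqP; rewrite eq_sym; apply/negPn/negP => /(subsetP g_supp); rewrite xc.
    rewrite card_family foldrE big_map big_enum /= (bigID (mem c)) /=.
    rewrite big1 ?mul1n => [|x xc]; last by rewrite /F xc card1.
    rewrite -prod_nat_const; apply: eq_big => [x|x xc]; first by rewrite inE.
    by rewrite /F (negbTE xc); apply: eq_card => y; rewrite !inE.
  move=> f; rewrite !inE => /andP[/ffun_onP fU Pf]; apply/andP; split.
    apply/pffun_onP; split; last by move=> _ /imageP[x xc ->]; rewrite ffunE xc fU.
    by apply/subsetP => x; rewrite inE ffunE; case: ifP => //; rewrite eqxx.
  by rewrite (P_dep _ f) // => x xc; rewrite ffunE xc.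
by rewrite -mulnA -expnD addnC cardsC.
Qed.

Section RandomChoice.
Variables (G : sgraph) (T I : finType) (chunk : I -> {set T}) (B : {set T}).
Variables (W used : {set G}) (r Q : nat).
Hypothesis G_gt0 : 0 < #|G|.
Hypothesis dense : forall y : G, #|G| <= 3 * degree y.
Hypothesis W_large : #|G| <= 4 * #|W|.
Hypothesis used_small : 200 * #|used| <= #|G|.
Hypothesis r_gt0 : 0 < r.
Hypothesis chunk_small : forall e, #|chunk e| <= r.+1.
Hypothesis B_small : #|B| <= Q.
Hypothesis Q_small : 180 * r * 4 ^ r * Q <= #|G|.

Let n := #|G|.
Let W' := W :\: used.
Let U w := [set u in W' | adj w u].
Let centers := [set w | (w \notin used) && (#|W'| <= 4 * #|U w|)].

Let W'_large : n <= 5 * #|W'|.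
Proof.
have := cardsID used W; have : #|W :&: used| <= #|used|.
  by apply/subset_leq_card/subsetIr.
by rewrite -/W' /n; lia.
Qed.

Let centers_large : n <= 15 * #|centers|.
Proof.
have count_edges : #|W'| * (197 * n) <= \sum_(w | w \notin used) 600 * #|U w|.
  apply: (@leq_trans (\sum_(u in W') 600 * #|[set w | adj u w] :\: used|)).
    rewrite -sum_nat_const; apply: leq_sum => u _.
    have := cardsID used [set w | adj u w].
    have : #|[set w | adj u w] :&: used| <= #|used|.
      by apply/subset_leq_card/subsetIr.
    by have := dense u; rewrite /degree /n; lia.
  rewrite -!big_distrr leq_mul2l /=; apply/eq_leq.
  under eq_bigr => u _ do rewrite -sum1_card.
  rewrite (exchange_big_dep (fun w => w \notin used)) /=; last first.
    by move=> u w _; rewrite inE => /andP[].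
  apply: eq_bigr => w w_used; rewrite sum1dep_card; apply: eq_card => u.
  by rewrite !inE w_used /= adj_sym.
have : \sum_(w | w \notin used) 600 * #|U w| <= #|centers| * (600 * #|W'|) + n * (150 * #|W'|).
  rewrite (bigID (mem centers)) /=; apply: leq_add.
    rewrite (eq_bigl (mem centers)) => [|w]; last by rewrite /= inE; case: (w \notin used).
    rewrite -sum_nat_const; apply: leq_sum => w _; rewrite leq_mul2l /=.
    by apply/subset_leq_card/subsetP => u; rewrite inE => /andP[].
  apply: (@leq_trans (\sum_(w : G) 150 * #|W'|)); last by rewrite sum_nat_const.
  rewrite [X in _ <= X](bigID (fun w => (w \notin used) && (w \notin centers))) /=.
  apply: leq_trans (leq_addr _ _); apply: leq_sum => w.
  by rewrite inE => /andP[->]; rewrite /= -ltnNge; lia.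
have := W'_large; have : 0 < n by []; move: count_edges.
move: (\sum_(_ | _) _) => S; nia.
Qed.

Import Order.TTheory GRing.Theory Num.Theory.
Local Open Scope ring_scope.

(** With [pr] below, this is the uniform distribution on functions from [T] to [U w]. *)
Let count w (P : pred {ffun T -> G}) := #|[set f in ffun_on (U w) | P f]|.
Let pr w (P : pred {ffun T -> G}) : rat := (count w P)%:R / (#|U w| ^ #|T|)%:R.

Let U_gt0 w : w \in centers -> (0 < #|U w|)%N.
Proof.
rewrite inE => /andP[_]; have := W'_large; have : (0 < n)%N by [].
by case: #|U w| => //; lia.
Qed.

Let small e (f : {ffun T -> G}) :=
  (#|[set b | (b \notin used) && [forall k in chunk e, adj b (f k)]]| < Q)%N.

Let pr_restrict w (c : {set T}) x0 (P : pred {ffun T -> G}) : w \in centers ->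
    (forall f g : {ffun T -> G}, {in c, f =1 g} -> P f = P g) ->
  pr w P = #|[set g in pffun_on x0 c (U w) | P g]|%:R / (#|U w| ^ #|c|)%:R.
Proof.
move=> /U_gt0 Uw_gt0 P_dep; have := card_ffun_on_restrict x0 (U w) P_dep.
rewrite -/(count w P) /pr => /(congr1 (fun k : nat => k%:R : rat)).
rewrite !natrM => eq_count; apply/eqP.
rewrite eqr_div ?pnatr_eq0 -?lt0n ?expn_gt0 ?Uw_gt0 //.
by apply/eqP; rewrite [LHS]eq_count.
Qed.

(** A restricted function with equal values at [k] and [k'] is determined by its value at [k], so
    the probability is at most 1/#|U w|; and #|U w| is at least #|W'|/4, hence at least n/20. *)
Let pr_collision w k k' (p : rat) : w \in centers -> k != k' -> p * n%:R = 20 ->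
  pr w (fun f => f k == f k') <= p.
Proof.
move=> wC kk' pn; have /card_gt0P[x0 _] := G_gt0.
rewrite (pr_restrict (c := [set k; k']) x0) //; last first.
  by move=> f g fg; rewrite !fg ?set21 ?set22.
have leU : (#|[set g in pffun_on x0 [set k; k'] (U w) | (g : {ffun T -> G}) k == g k']|
    <= #|U w|)%N.
  rewrite -(card_in_imset (f := fun g : {ffun T -> G} => g k)).
    apply/subset_leq_card/subsetP => _ /imsetP[g + ->].
    rewrite inE => /andP[/pffun_onP[_ gU] _].
    by apply: gU; apply/imageP; exists k; rewrite ?set21.
  move=> f g; rewrite !inE => /andP[/pffun_onP[f_supp _] /eqP fk].
  move=> /andP[/pffun_onP[g_supp _] /eqP gk] fg.
  apply/ffunP => x; have [/set2P[]->//|xk] := boolP (x \in [set k; k']).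
    by rewrite -fk -gk.
  have -> : f x = x0 by apply/eqP/negPn/negP => /(subsetP f_supp); rewrite (negbTE xk).
  by apply/esym/eqP/negPn/negP => /(subsetP g_supp); rewrite (negbTE xk).
have Uw_gt0 : 0 < #|U w|%:R :> rat by rewrite ltr0n U_gt0.
have n_gt0 : 0 < n%:R :> rat by rewrite ltr0n.
rewrite cards2 kk' ler_pdivrMr ?ltr0n ?expn_gt0 ?U_gt0 // natrX.
apply: (@le_trans _ _ #|U w|%:R); first by rewrite ler_nat.
rewrite expr2 mulrA -{1}[#|U w|%:R]mul1r ler_pM2r // -(ler_pM2r n_gt0) mul1r mulrAC pn.
rewrite -natrM ler_nat; move: wC; rewrite inE => /andP[_].
by have := W'_large; lia.
Qed.

(* A tuple with few common neighbours lies in the neighbourhood of few w. *)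
Let sum_pr_small e : \sum_(w in centers) pr w (small e) <= (4 ^ r.+1 * Q)%:R.
Proof.
have /card_gt0P[x0 _] := G_gt0.
have small_dep (f g : {ffun T -> G}) : {in chunk e, f =1 g} -> small e f = small e g.
  move=> fg; rewrite /small; congr (_ < Q)%N; apply: eq_card => b; rewrite !inE.
  congr (_ && _); apply/eq_forallb => k.
  by case: (boolP (k \in chunk e)) => //= kc; rewrite fg.
set c := chunk e in small_dep *; have W'_gt0 : (0 < #|W'|)%N.
  by have := W'_large; have : (0 < n)%N by []; lia.
have W'_gt0' : 0 < (#|W'| ^ #|c|)%:R :> rat by rewrite ltr0n expn_gt0 W'_gt0.
(* Since #|U w| is at least #|W'|/4, all denominators become a power of #|W'| at the price of a
   factor 4 per coordinate. *)
apply: (@le_trans _ _ (\sum_(w in centers)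
    #|[set g in pffun_on x0 c (U w) | small e g]|%:R * ((4 ^ #|c|)%:R / (#|W'| ^ #|c|)%:R))).
  apply: ler_sum => w wC; rewrite (pr_restrict (c := c) x0) //.
  apply: ler_wpM2l => //; rewrite ler_pdivlMr // mulrC ler_pdivrMr ?ltr0n ?expn_gt0 ?U_gt0 //.
  have UW : (#|W'| <= 4 * #|U w|)%N by move: wC; rewrite inE => /andP[].
  rewrite -natrM ler_nat -expnMn mulnC.
  by case: (posnP #|c|) => [->//|c_gt0]; rewrite leq_exp2r // mulnC.
rewrite -mulr_suml -natr_sum mulrA ler_pdivrMr // -!natrM ler_nat.
have count_small : (\sum_(w in centers) #|[set g in pffun_on x0 c (U w) | small e g]|
    <= #|W'| ^ #|c| * Q)%N.
  under eq_bigr => w _ do rewrite -sum1_card.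
  rewrite (exchange_big_dep [pred g | (g \in pffun_on x0 c W') && small e g]) /=; last first.
    move=> w g _; rewrite !inE => /andP[/pffun_onP[g_supp gU] ->]; rewrite andbT.
    by apply/pffun_onP; split=> // u /gU; rewrite inE => /andP[].
  apply: (@leq_trans (\sum_(g in pffun_on x0 c W') Q)); last first.
    by rewrite sum_nat_const card_pffun_on.
  rewrite [X in (_ <= X)%N](bigID (small e)) /=; apply: leq_trans (leq_addr _ _).
  apply: leq_sum => g /andP[_ g_small]; rewrite sum1dep_card.
  apply: leq_trans (ltnW g_small); apply/subset_leq_card/subsetP => w.
  rewrite !inE => /andP[/andP[-> _] /andP[/pffun_onP[_ gU] _]] /=.
  apply/forallP => k; apply/implyP => kc.
  by have := gU (g k) (image_f _ kc); rewrite inE => /andP[].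
apply: leq_trans (leq_mul count_small (leqnn _)) _.
rewrite mulnAC [(#|W'| ^ _ * _)%N]mulnC mulnAC.
by rewrite leq_mul2r leq_mul2r leq_exp2l // chunk_small !orbT.
Qed.

(** First moment over a uniform centre [w] and a uniform [f] into [U w]. A chunk is bad if it has
    few common neighbours or if one of its values is repeated on [B]. Each cause accounts for at
    most #|I|/(3r) chunks on average, so some choice has at most #|I|/r bad ones. *)
Lemma random_choice : exists (f : T -> G) (good : {set I}),
  [/\ (r * #|~: good| <= #|I|)%N,
      forall k, f k \in W :\: used,
      forall e, e \in good ->
        (Q <= #|[set b | (b \notin used) && [forall k in chunk e, adj b (f k)]]|)%N &
      forall e k k', e \in good -> k \in chunk e -> k' \in B -> f k = f k' -> k = k'].
Proof.
pose clash e (f : {ffun T -> G}) :=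
  [exists k in chunk e, [exists k' in B, (k != k') && (f k == f k')]].
pose bad e f := small e f || clash e f.
suff [w [f [wC /ffun_onP fU f_bad]]] : exists w f, [/\ w \in centers, f \in ffun_on (U w) &
    (r * #|[set e | bad e f]| <= #|I|)%N].
  exists f, [set e | ~~ bad e f]; split=> [|k|e|e k k'].
  - suff -> : ~: [set e | ~~ bad e f] = [set e | bad e f] by [].
    by apply/setP => e; rewrite !inE negbK.
  - by have := fU k; rewrite inE => /andP[].
  - by rewrite inE negb_or => /andP[]; rewrite /small -leqNgt.
  - rewrite inE negb_or => /andP[_ /existsPn/(_ k)] + kc k'B fk; rewrite kc /=.
    by move=> /existsPn/(_ k'); rewrite k'B fk eqxx andbT /= negbK => /eqP.
have [/existsP[w /andP[wC /existsP[f /andP[fU f_bad]]]]|/existsPn all_bad] :=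
  boolP [exists w, (w \in centers) && [exists f, (f \in ffun_on (U w)) &&
    (r * #|[set e | bad e f]| <= #|I|)%N]]; first by exists w, f.
have {}all_bad w f : w \in centers -> f \in ffun_on (U w) ->
    (#|I| < r * #|[set e | bad e f]|)%N.
  move=> wC fU; have := all_bad w; rewrite wC /= => /existsPn/(_ f).
  by rewrite fU /= -ltnNge.
have n_gt0 : 0 < n%:R :> rat by rewrite ltr0n.
have [p p_ge0 pn] : exists2 p : rat, 0 <= p & p * n%:R = 20.
  by exists (20 / n%:R); rewrite ?divr_ge0 ?ler0n // divfK // gt_eqF.
(* The strict inequality of [all_bad] is kept as [#|I|.+1], so that the final contradiction also
   covers an empty [I]. *)
have sum_bad w : w \in centers -> #|I|.+1%:R <= r%:R * \sum_e pr w (bad e).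
  move=> wC; rewrite /pr -mulr_suml mulrA ler_pdivlMr ?ltr0n ?expn_gt0 ?U_gt0 //.
  have cardU : #|[pred f : {ffun T -> G} | f \in ffun_on (U w)]| = (#|U w| ^ #|T|)%N.
    by rewrite -card_ffun_on; apply: eq_card.
  rewrite -natr_sum -!natrM ler_nat -cardU mulnC -sum_nat_const.
  apply: (@leq_trans (\sum_(f in [pred f : {ffun T -> G} | f \in ffun_on (U w)])
      r * #|[set e | bad e f]|)).
    by apply: leq_sum => f; rewrite inE => fU; apply: (all_bad w).
  rewrite -big_distrr leq_mul2l /= /count; apply/orP; right; apply/eq_leq.
  under [RHS]eq_bigr => e _ do rewrite -sum1dep_card.
  rewrite (exchange_big_dep (mem (ffun_on (U w)))) /=; last by move=> e f _ /andP[].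
  apply: eq_big => [f|f fU]; first by rewrite inE.
  by rewrite -sum1dep_card; apply: eq_bigl => e; rewrite fU.
(* Union bound over at most [r.+1 * Q] pairs of a chunk vertex and a vertex of [B]. *)
have pr_bad w e : w \in centers ->
    pr w (bad e) <= pr w (small e) + (r.+1 * Q)%:R * p.
  move=> wC.
  apply: (@le_trans _ _ (pr w (small e) + \sum_(k in chunk e) \sum_(k' in B | k != k')
      pr w (fun f => f k == f k'))).
    under eq_bigr => k _ do rewrite -mulr_suml -natr_sum.
    rewrite -mulr_suml -natr_sum -mulrDl -natrD ler_wpM2r ?invr_ge0 // ler_nat.
    apply: (@leq_trans #|[set f in ffun_on (U w) | small e f] :|:
       \bigcup_(k in chunk e) \bigcup_(k' in B | k != k')
         [set f in ffun_on (U w) | f k == f k']|).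
      apply/subset_leq_card/subsetP => f; rewrite !inE => /andP[fU /orP[f_small|]].
        by rewrite fU f_small.
      case/existsP=> k /andP[kc /existsP[k' /and3P[k'B kk' fk]]]; apply/orP; right.
      by apply/bigcupP; exists k => //; apply/bigcupP; exists k'; rewrite ?k'B ?inE ?fU.
    apply: leq_trans (leq_card_setU _ _).1 _; rewrite leq_add2l.
    apply: leq_trans (card_bigcup_le _ _) _; apply: leq_sum => k _.
    exact: card_bigcup_le.
  rewrite lerD2l; apply: (@le_trans _ _ (\sum_(k in chunk e) \sum_(k' in B) p)).
    apply: ler_sum => k _; rewrite [X in _ <= X](bigID (fun k' => k != k')) /=.
    apply: ler_wpDr; first by apply: sumr_ge0 => *; exact: p_ge0.
    by apply: ler_sum => k' /andP[_ kk']; apply: pr_collision.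
  rewrite sumr_const sumr_const -mulrnA -[X in X <= _]mulr_natl.
  apply: ler_wpM2r; first by [].
  by rewrite ler_nat mulnC leq_mul ?chunk_small.
have : \sum_(w in centers) #|I|.+1%:R <= r%:R * (#|I|%:R * (4 ^ r.+1 * Q)%:R +
    #|centers|%:R * #|I|%:R * ((r.+1 * Q)%:R * p)) :> rat.
  apply: (@le_trans _ _ (\sum_(w in centers) r%:R * \sum_e
      (pr w (small e) + (r.+1 * Q)%:R * p))).
    apply: ler_sum => w wC; apply: le_trans (sum_bad w wC) _.
    by apply: ler_wpM2l => //; apply: ler_sum => e _; apply: pr_bad.
  rewrite -mulr_sumr ler_wpM2l // exchange_big /=.
  under eq_bigr => e _ do rewrite big_split /= sumr_const -mulr_natl.
  rewrite big_split /= sumr_const -[X in _ + X]mulr_natl mulrA.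
  have -> : #|xpredT : pred I| = #|I| by [].
  apply: lerD; last by rewrite -[_ *+ _]mulr_natl le_eqVlt; apply/orP; left; apply/eqP; ring.
  rewrite mulr_natl -sumr_const.
  by apply: ler_sum => e _; apply: sum_pr_small.
rewrite sumr_const -[X in X <= _]mulr_natl.
have c_gt0 : 0 < #|centers|%:R :> rat.
  by rewrite ltr0n; have := centers_large; have : (0 < n)%N by []; lia.
move=> contra; exfalso; move: contra; apply/negP; rewrite -ltNge mulrDr.
have I_ge0 : 0 <= #|I|%:R :> rat by [].
(* Here 180 = 3 * 4 * 15: a third of the budget, the extra factor 4 in 4^(r+1), and
   [centers_large]. *)
have bound1 : r%:R * (4 ^ r.+1 * Q)%:R * 3 <= #|centers|%:R :> rat.
  rewrite -!natrM ler_nat; have := centers_large; rewrite expnS; move: Q_small.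
  by rewrite -/n; lia.
(* The left side is 60 r (r+1) Q / n, and r + 1 is at most 4^r. *)
have bound2 : r%:R * ((r.+1 * Q)%:R * p) * 3 <= 1 :> rat.
  rewrite -(ler_pM2r n_gt0) mul1r.
  have -> : r%:R * ((r.+1 * Q)%:R * p) * 3 * n%:R =
      r%:R * (r.+1 * Q)%:R * 3 * (p * n%:R) by ring.
  rewrite pn -!natrM ler_nat.
  apply: leq_trans Q_small.
  have := ltn_expl r (isT : (1 < 4)%N); move: (4 ^ r)%N => x; nia.
rewrite -natr1.
move: bound1 bound2; set x := r%:R * (4 ^ r.+1 * Q)%:R; set y := r%:R * ((r.+1 * Q)%:R * _).
move=> bound1 bound2.
have -> : r%:R * (#|I|%:R * (4 ^ r.+1 * Q)%:R) = #|I|%:R * x by rewrite /x; ring.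
have -> : r%:R * (#|centers|%:R * #|I|%:R * ((r.+1 * Q)%:R * p)) =
    #|centers|%:R * #|I|%:R * y by rewrite /y; ring.
have := ler_wpM2l I_ge0 bound1; have ci_ge0 := mulr_ge0 (ltW c_gt0) I_ge0.
have := ler_wpM2l ci_ge0 bound2.
by clearbody x y; lra.
Qed.

End RandomChoice.

(** * Embedding one part of the decomposition *)

Section Models.
Variables (G : sgraph) (T : finType) (W : {set G}) (h : T -> G).
Hypothesis W_linked : linked W.
Hypothesis hW : forall x, h x \in W.

(** A minor model containing the hubs, with no condition on edges yet. Branch sets only grow, so an
    edge once realized stays realized. *)
Definition rooted_family (br : T -> {set G}) :=
  [/\ forall x, connected_in (br x), forall x, h x \in br x &
      forall x y, x != y -> [disjoint br x & br y]].

Definition joined (br : T -> {set G}) (x y : T) :=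
  exists u v, [/\ u \in br x, v \in br y & adj u v].

Definition occupied (br : T -> {set G}) := \bigcup_x br x.

Lemma joined_sub (br br' : T -> {set G}) (x y : T) :
  (forall z, br z \subset br' z) -> joined br x y -> joined br' x y.
Proof.
move=> sub [u [v [ux vy uv]]]; exists u, v; split=> //; exact: (subsetP (sub _)).
Qed.

Lemma sub_occupied (br : T -> {set G}) (x : T) : br x \subset occupied br.
Proof. exact: bigcup_sup. Qed.

Lemma rooted_family_grow (br A : T -> {set G}) :
    rooted_family br -> (forall x, [disjoint A x & occupied br]) ->
    (forall x y, x != y -> [disjoint A x & A y]) ->
    (forall x u, u \in A x -> connect (inner_adj (br x :|: A x)) (h x) u) ->
  rooted_family (fun x => br x :|: A x).
Proof.
move=> [br_con br_h br_disj] A_span A_disj A_con; split=> [x|x|x y xy].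
- apply: connected_extend (br_con x) (subsetUl _ _) _ => u /setUP[uB|uA].
    by exists u; rewrite ?connect0.
  by exists (h x); rewrite ?A_con.
- by rewrite inE br_h.
- have dis z t : [disjoint A z & br t] by apply: disjointWr (sub_occupied br t) (A_span z).
  by rewrite -!setI_eq0 setIUl !setIUr !setU_eq0 !setI_eq0 br_disj // A_disj //
    dis disjoint_sym dis.
Qed.

Lemma occupied_grow (br A : T -> {set G}) (S : {set G}) :
  (forall x, A x \subset S) -> #|occupied (fun x => br x :|: A x)| <= #|occupied br| + #|S|.
Proof.
move=> AS; apply: leq_trans (leq_card_setU _ _).1.
apply/subset_leq_card/bigcupsP => x _; apply: setUSS; first exact: sub_occupied.
exact: AS.
Qed.

Lemma link_connect (S : {set G}) (u x z y : G) :
    adj u x -> adj x z -> adj z y -> u \in S -> [set x; z; y] \subset S ->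
  {in [set x; z; y], forall t, connect (inner_adj S) u t}.
Proof.
move=> ux xz zy uS /subsetP sub.
have xS : x \in S by apply: sub; rewrite !inE eqxx.
have zS : z \in S by apply: sub; rewrite !inE eqxx orbT.
have yS : y \in S by apply: sub; rewrite !inE eqxx !orbT.
have cx := inner_connect1 ux uS xS; have cz := connect_trans cx (inner_connect1 xz xS zS).
have cy := connect_trans cz (inner_connect1 zy zS yS).
by move=> t; rewrite !inE -orbA => /or3P[] /eqP->.
Qed.

Lemma card_set3_le (x y z : G) : #|[set x; y; z]| <= 3.
Proof.
apply: leq_trans (leq_card_setU _ _).1 _; rewrite cards1 addn1 ltnS cards2.
by case: (_ != _).
Qed.

(** All inner vertices of a link from [h x] to [h y] go to [x]; its last edge then joins the two
    branch sets. *)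
Lemma join_pair (br : T -> {set G}) (x y : T) :
    rooted_family br -> 200 * #|occupied br| <= num_vertices G ->
  exists br', [/\ rooted_family br', forall z, br z \subset br' z,
    #|occupied br'| <= #|occupied br| + 3 & joined br' x y].
Proof.
move=> br_ok small; have [_ br_h _] := br_ok.
have [p [z [q [pS zS qS [xp pz zq qy]]]]] := W_linked (hW x) (hW y) small.
pose A t := if t == x then [set p; z; q] else set0.
exists (fun t => br t :|: A t); split=> [|t||].
- apply: rooted_family_grow => // [t|t s ts|t u].
  + rewrite /A; case: ifP => _; last by apply/pred0P => u; rewrite /= inE.
    apply/pred0P => u /=; rewrite !inE -orbA.
    by apply/negbTE; rewrite negb_and -implybE; apply/implyP => /or3P[] /eqP->.
  + rewrite /A; case: eqP => [tx|_]; last by apply/pred0P => u; rewrite /= inE.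
    case: eqP => [sx|_]; first by rewrite tx sx eqxx in ts.
    by apply/pred0P => u; rewrite /= !inE andbF.
  + rewrite /A; case: eqP => [->|_]; last by rewrite inE.
    by move=> uA; apply: (link_connect xp pz zq) uA; rewrite ?subsetUr // inE br_h.
- exact: subsetUl.
- apply: leq_trans (occupied_grow _ (S := [set p; z; q]) _) _ => [t|].
    by rewrite /A; case: ifP; rewrite ?sub0set.
  by rewrite leq_add2l card_set3_le.
- exists q, (h y); split=> //; last by rewrite inE br_h.
  by rewrite /A eqxx !inE eqxx !orbT.
Qed.

Lemma join_pairs (l : seq (T * T)) (br : T -> {set G}) :
    rooted_family br -> 200 * (#|occupied br| + 3 * size l) <= num_vertices G ->
  exists br', [/\ rooted_family br', forall z, br z \subset br' z,
    #|occupied br'| <= #|occupied br| + 3 * size l &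
    forall x y, (x, y) \in l -> joined br' x y].
Proof.
elim: l br => [|[x y] l IHl] br br_ok /= small.
  by exists br; split=> //; rewrite addn0.
have [|br1 [br1_ok sub1 le1 join1]] := @join_pair br x y br_ok; first by lia.
have [|br2 [br2_ok sub2 le2 join2]] := IHl br1 br1_ok; first by lia.
exists br2; split=> // [z||z t].
- exact: subset_trans (sub1 z) (sub2 z).
- by lia.
- by rewrite inE => /orP[/eqP[-> ->]|/join2//]; apply: joined_sub join1.
Qed.

Variables (I : finType) (center : I -> T) (chunk : I -> {set T}) (B : {set T}).
Variables (r Q : nat).
Hypothesis G_gt0 : 0 < num_vertices G.
Hypothesis dense : forall y : G, num_vertices G <= 3 * degree y.
Hypothesis W_large : num_vertices G <= 4 * #|W|.
Hypothesis r_gt0 : 0 < r.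
Hypothesis chunk_small : forall e, #|chunk e| <= r.+1.
Hypothesis chunk_sub : forall e, chunk e \subset B.
Hypothesis center_chunk : forall e, center e \in chunk e.
Hypothesis Q_large : #|B| + #|I| <= Q.
Hypothesis Q_small : 180 * r * 4 ^ r * Q <= num_vertices G.

(** The vertex [k] receives [f k] and a link [X k] to its hub, four vertices in all. The centre of a
    good chunk [e] also receives a common neighbour [b e] of all [f k] with [k] in the chunk. The
    failed chunks need at most #|I| further links of three vertices, hence the cost 4#|B| +
    4#|I|. *)
Lemma embed_piece (br : T -> {set G}) :
    rooted_family br -> 200 * (#|occupied br| + 4 * #|B| + 4 * #|I|) <= num_vertices G ->
  exists br', [/\ rooted_family br', forall z, br z \subset br' z,
    #|occupied br'| <= #|occupied br| + 4 * #|B| + 4 * #|I| &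
    forall e y, y \in chunk e -> y != center e -> joined br' (center e) y].
Proof.
move=> br_ok small; have [_ br_h _] := br_ok.
have small0 : 200 * #|occupied br| <= num_vertices G by lia.
have leBQ : #|B| <= Q by lia.
have [f [good [few_bad f_W f_common f_inj]]] :=
  random_choice G_gt0 dense W_large small0 r_gt0 chunk_small leBQ Q_small.
(* Injectivity of [f] is known only on vertices of good chunks, so only these receive their
   vertex. *)
pose active := \bigcup_(e in good) chunk e.
have active_B : active \subset B by apply/bigcupsP => e _; apply: chunk_sub.
have f_inj_active : {in active &, injective f}.
  move=> k k' /bigcupP[e eg ke] k'A; apply: (f_inj e) => //.
  exact: (subsetP active_B).
pose F := f @: active.
have leF : #|F| <= #|B|.
  by apply: leq_trans (leq_imset_card _ _) (subset_leq_card active_B).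
pose cand e := [set b | (b \notin occupied br) && [forall k in chunk e, adj b (f k)]] :\: F.
have /card_gt0P[v0 _] := G_gt0.
have leg : #|good| <= #|I| by apply: max_card.
(* At least Q - #|F| candidates remain, which is at least #|I| because Q is at least #|B| + #|I|. *)
have [|b [b_cand b_inj]] := @distinct_representatives I G v0 good cand.
  move=> e eg; have := f_common e eg.
  have := cardsID F [set b | (b \notin occupied br) && [forall k in chunk e, adj b (f k)]].
  have : #|[set b | (b \notin occupied br) && [forall k in chunk e, adj b (f k)]] :&: F|
      <= #|F|.
    by apply/subset_leq_card/subsetIr.
  by rewrite /cand; lia.
pose Z := b @: good.
have leZ : #|Z| <= #|I| by apply: leq_trans (leq_imset_card _ _) leg.
pose is_link k (X : {set G}) := exists p z q,
  [/\ X = [set p; z; q], adj (h k) p, adj p z, adj z q & adj q (f k)].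
have leActive := subset_leq_card active_B.
have [k Fb' kA leFb'||X [X_ok X_disj]] := @disjoint_choice T G is_link 3
    (#|occupied br| + 4 * #|B| + 4 * #|I|) active (occupied br :|: F :|: Z).
- have fkW : f k \in W by have := f_W k; rewrite inE => /andP[].
  have [|p [z [q [pF zF qF [hp pz zq qf]]]]] := W_linked (hW k) fkW (Fb := Fb').
    by rewrite -[leqRHS]/(num_vertices G); lia.
  exists [set p; z; q]; split; [|exact: card_set3_le|by exists p, z, q].
  apply/pred0P => u /=; rewrite !inE -orbA.
  by apply/negbTE; rewrite negb_and -implybE; apply/implyP => /or3P[] /eqP->.
- have [+ _] := leq_card_setU (occupied br :|: F) Z.
  by have [+ _] := leq_card_setU (occupied br) F; lia.
pose A k := (if k \in active then f k |: X k else set0) :|: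
  [set b e | e in [set e in good | center e == k]].
have AP k u : u \in A k -> [\/ k \in active /\ u = f k, k \in active /\ u \in X k |
    exists e, [/\ e \in good, center e = k & u = b e]].
  rewrite inE => /orP[|/imsetP[e]].
    case: ifP => kA; last by rewrite inE.
    by case/setU1P=> [->|uX]; [constructor 1|constructor 2].
  by rewrite inE => /andP[eg /eqP ek] ->; constructor 3; exists e.
have f_span k : f k \notin occupied br by have := f_W k; rewrite inE => /andP[].
have b_ok e : e \in good -> [/\ b e \notin F, b e \notin occupied br &
    forall k, k \in chunk e -> adj (b e) (f k)].
  move=> eg; have := b_cand e eg; rewrite !inE => /and3P[bF bS /forallP be]; split=> // k kc.
  by have := be k; rewrite kc.
have center_active e : e \in good -> center e \in active.
  by move=> eg; apply/bigcupP; exists e.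
have X_ok' k : k \in active -> [/\ [disjoint X k & occupied br], [disjoint X k & F],
    [disjoint X k & Z], #|X k| <= 3 & is_link k (X k)].
  move=> kA; have [dis le3 lk] := X_ok k kA; split=> //; apply: disjointWr dis.
  - by rewrite -setUA subsetUl.
  - by rewrite -setUA subsetU // subsetUl orbT.
  - by rewrite subsetUr.
have fF k : k \in active -> f k \in F by move=> kA; apply: imset_f.
have bZ e : e \in good -> b e \in Z by move=> eg; apply: imset_f.
have A_disj k l u : u \in A k -> u \in A l -> k = l.
  move=> /AP ukA /AP ulA; case: ukA ulA => [[kA ->]|[kA uk]|[e [eg <- ->]]].
  - case=> [[lA]|[lA ul]|[e [eg <- fb]]]; first exact: f_inj_active.
      by have [_ dF _ _ _] := X_ok' l lA; have := disjointFr dF ul; rewrite fF.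
    by have [/negP[]] := b_ok e eg; rewrite -fb fF.
  - have [_ dF dZ _ _] := X_ok' k kA.
    case=> [[lA uE]|[lA ul]|[e [eg _ uE]]].
    + by have := disjointFr dF uk; rewrite uE fF.
    + by apply/eqP/negPn/negP => kl; rewrite (disjointFr (X_disj k l kA lA kl) uk) in ul.
    + by have := disjointFr dZ uk; rewrite uE bZ.
  - case=> [[lA bf]|[lA ul]|[e' [eg' <- bb]]].
    + by have [/negP[]] := b_ok e eg; rewrite bf fF.
    + by have [_ _ dZ _ _] := X_ok' l lA; have := disjointFr dZ ul; rewrite bZ.
    + by rewrite (b_inj e e' eg eg' bb).
have A_sub k : A k \subset F :|: Z :|: \bigcup_(l in active) X l.
  apply/subsetP => u /AP[[kA ->]|[kA uX]|[e [eg _ ->]]]; rewrite !inE.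
  - by rewrite fF.
  - by apply/orP; right; apply/bigcupP; exists k.
  - by rewrite bZ // orbT.
have br1_ok : rooted_family (fun k => br k :|: A k).
  apply: rooted_family_grow => // [k|k l kl|k].
  - apply/pred0P => u /=; apply/negbTE/negP => /andP[/AP[[_ ->]|[kA uX]|[e [eg _ ->]]]].
    + by rewrite (negbTE (f_span k)).
    + by have [dS _ _ _ _] := X_ok' k kA; rewrite (disjointFr dS uX).
    + by have [_ /negbTE->] := b_ok e eg.
  - apply/pred0P => u /=; apply/negbTE/negP => /andP[uk ul].
    by rewrite (A_disj k l u uk ul) eqxx in kl.
  - have hk : h k \in br k :|: A k by rewrite inE br_h.
    have con_f : k \in active -> forall u, u \in f k |: X k ->
        connect (inner_adj (br k :|: A k)) (h k) u.
      move=> kA u; have subA : f k |: X k \subset br k :|: A k.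
        by rewrite /A kA; apply: subset_trans (subsetUl _ _) (subsetUr _ _).
      have [_ _ _ _ [p [z [q [XE hp pz zq qf]]]]] := X_ok' k kA.
      have subX : [set p; z; q] \subset br k :|: A k.
        by rewrite -XE; apply: subset_trans subA; apply: subsetUr.
      have con := link_connect hp pz zq hk subX.
      case/setU1P=> [->|uX]; last by apply: con; rewrite -XE.
      have qX : q \in [set p; z; q] by rewrite !inE eqxx !orbT.
      apply: connect_trans (con q qX) _; apply: inner_connect1 => //.
        exact: (subsetP subX).
      by apply: (subsetP subA); rewrite setU11.
    move=> u uA; case: (AP k u uA) => [[kA ->]|[kA uX]|[e [eg ek uE]]].
    + by apply: con_f; rewrite ?setU11.
    + by apply: con_f; rewrite // inE uX orbT.
    + have kA : k \in active by rewrite -ek center_active.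
      apply: connect_trans (con_f kA (f k) (setU11 _ _)) _; apply: inner_connect1.
      * by rewrite uE adj_sym; have [_ _] := b_ok e eg; apply; rewrite -ek.
      * by rewrite !inE kA !inE eqxx orbT.
      * by rewrite inE uA orbT.
have le1 : #|occupied (fun k => br k :|: A k)| <= #|occupied br| + (#|B| + #|I| + 3 * #|B|).
  apply: leq_trans (occupied_grow _ A_sub) _; rewrite leq_add2l.
  apply: leq_trans (leq_card_setU _ _).1 (leq_add _ _).
    by apply: leq_trans (leq_card_setU _ _).1 (leq_add leF leZ).
  apply: (@leq_trans (\sum_(l in active) 3)); last first.
    by rewrite sum_nat_const mulnC leq_mul2l.
  apply: (@leq_trans (\sum_(l in active) #|X l|)).
    exact: card_bigcup_le.
  by apply: leq_sum => l /X_ok'[].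
(* At most #|I|/r chunks fail and each has at most r vertices besides its centre, so at most #|I|
   pairs remain. *)
pose fails := [seq (center e, k) | e <- enum (~: good), k <- enum (chunk e :\ center e)].
have le_fails : size fails <= #|I|.
  rewrite size_allpairs_dep; apply: leq_trans few_bad.
  rewrite sumnE big_map big_enum /= mulnC -sum_nat_const.
  apply: leq_sum => e _; rewrite -cardE -ltnS; apply: leq_trans (chunk_small e).
  by rewrite [X in _ <= X](cardsD1 (center e)) center_chunk.
have [|br2 [br2_ok sub2 le2 join2]] := join_pairs (l := fails) br1_ok.
  by lia.
exists br2; split=> // [z||e y yc ye].
- by apply: subset_trans (sub2 z); apply: subsetUl.
- by lia.
have [eg|eb] := boolP (e \in good); last first.
  apply: join2; apply/allpairsPdep; exists e, y.
  by rewrite !mem_enum !inE eb ye yc.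
apply: joined_sub sub2 _; exists (b e), (f y).
have yA : y \in active by apply/bigcupP; exists e.
rewrite !inE yA !inE eqxx /= orbT; split=> //.
  by apply/orP; right; apply/orP; right; apply/imsetP; exists e; rewrite ?inE ?eg ?eqxx.
by have [_ _] := b_ok e eg; apply.
Qed.

End Models.

(** * Embedding the whole graph *)

(* The last chunk is empty when r divides #|S|. *)
Definition chunks (T : finType) (r : nat) (S : {set T}) : seq {set T} :=
  [seq [set x in take r (drop (i * r) (enum S))] | i <- iota 0 (#|S| %/ r).+1].

Lemma size_chunks (T : finType) (r : nat) (S : {set T}) :
  r * size (chunks r S) <= #|S| + r.
Proof.
by rewrite size_map size_iota mulnS addnC leq_add2r mulnC leq_trunc_div.
Qed.

Lemma card_chunks (T : finType) (r : nat) (S c : {set T}) :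
  c \in chunks r S -> #|c| <= r.
Proof.
case/mapP=> i _ ->; rewrite cardsE; apply: leq_trans (card_size _) _.
by rewrite size_take_min geq_minl.
Qed.

Lemma chunks_sub (T : finType) (r : nat) (S c : {set T}) (x : T) :
  c \in chunks r S -> x \in c -> x \in S.
Proof. by case/mapP=> i _ ->; rewrite inE => /mem_take/mem_drop; rewrite mem_enum. Qed.

Lemma mem_chunks (T : finType) (r : nat) (S : {set T}) (x : T) :
  0 < r -> x \in S -> exists2 c, c \in chunks r S & x \in c.
Proof.
move=> r_gt0 xS; set s := enum S; set j := index x s.
have xs : x \in s by rewrite mem_enum.
have js : j < size s by rewrite index_mem.
(* Position [j] of the enumeration lies in block [j %/ r] at offset [j %% r]. *)
exists [set y in take r (drop (j %/ r * r) s)].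
  apply/mapP; exists (j %/ r) => //.
  by rewrite mem_iota ltnS leq_div2r // cardE ltnW.
have xE : nth x (take r (drop (j %/ r * r) s)) (j %% r) = x.
  by rewrite nth_take ?ltn_pmod // nth_drop -divn_eq nth_index.
rewrite inE -{1}xE mem_nth // size_take_min size_drop.
by rewrite leq_min ltn_pmod // ltn_subRL -divn_eq.
Qed.

Section Assembly.
Variables (G H : sgraph) (back : H -> {set H}) (BB : {set {set H}}).
Variables (d C r : nat).
Hypothesis G_gt0 : 0 < num_vertices G.
Hypothesis dense : forall y : G, num_vertices G <= 3 * degree y.
Hypothesis back_small : forall x, #|back x| <= d.
Hypothesis back_cover : forall x y, adj x y -> y \in back x \/ x \in back y.
Hypothesis BB_dec : bounded_decomposition C BB.
Hypothesis r_gt0 : 0 < r.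

Let n := num_vertices G.
Let v := num_vertices H.
Let X := \sum_(B in BB) #|B|.

Hypothesis enough_room : 200 * (r * v + 8 * (r * X) + 4 * (d * v)) <= r * n.
Hypothesis sparse_pieces : 180 * 4 ^ r * (C * (d + 2 * r)) <= n.

(** One part is fixed for each edge, so that every edge is treated once; the default [set0] is never
    reached on an edge. *)
Let piece x y := odflt set0 [pick B in BB | (x \in B) && (y \in B)].

Let pieceP x y : adj x y -> [/\ piece x y \in BB, x \in piece x y & y \in piece x y].
Proof.
move=> /(BB_dec.1)[B BBB xyB]; rewrite /piece; case: pickP => [B' /and3P[]|/(_ B)] //=.
by rewrite BBB xyB.
Qed.

Let targets B x := [set y in back x | adj x y && (piece x y == B)].

(** The source [x] joins its chunk because the common neighbour must also be adjacent to the vertex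
    given to [x]. *)
Let pieces B := [seq (x, x |: c) | x <- enum B, c <- chunks r (targets B x)].

Let size_pieces B : r * size (pieces B) <= \sum_(x in B) #|targets B x| + r * #|B|.
Proof.
rewrite size_allpairs_dep sumnE big_map big_enum /= big_distrr /=.
rewrite [r * #|B|]mulnC -sum_nat_const -big_split /=.
by apply: leq_sum => x _; apply: size_chunks.
Qed.

Let targets_le B x : #|targets B x| <= d.
Proof.
apply: leq_trans (back_small x); apply/subset_leq_card/subsetP => y.
by rewrite inE => /andP[].
Qed.

Let targets_in B x y : y \in targets B x -> x \in B /\ y \in B.
Proof. by rewrite inE => /and3P[_ /pieceP[_ xp yp] /eqP <-]. Qed.

(** A part has at most C vertices, each with at most d/r + 1 chunks; together with #|B| this gives
    C(2 + d/r), multiplied here by r. *)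
Let piece_room B : B \in BB -> 180 * r * 4 ^ r * (#|B| + size (pieces B)) <= n.
Proof.
move=> BBB; apply: leq_trans sparse_pieces.
rewrite [180 * r]mulnC -!mulnA mulnCA leq_mul2l mulnCA leq_mul2l /=.
have le_B := BB_dec.2 B BBB; have := size_pieces B.
have : \sum_(x in B) #|targets B x| <= #|B| * d.
  by rewrite -sum_nat_const; apply: leq_sum => x _.
have := leq_mul le_B (leqnn (d + 2 * r)).
rewrite !mulnDr; move: (\sum_(_ in _) _) (size _) => S k; nia.
Qed.

(** Every edge is a target in one part only, so all parts together have at most dv/r + X chunks.
    This is where the terms 8X and 4dv/r of [enough_room] come from. *)
Let total_room :
  200 * (v + \sum_(B <- enum BB) (4 * #|B| + 4 * size (pieces B))) <= n.
Proof.
rewrite -(leq_pmul2l r_gt0); apply: leq_trans enough_room; rewrite mulnCA leq_mul2l /=.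
rewrite mulnDr -addnA leq_add2l big_enum /= big_split /= -!big_distrr /= -/X.
have : r * \sum_(B in BB) size (pieces B) <= d * v + r * X.
  rewrite /X !big_distrr /=; apply: (@leq_trans (\sum_(B in BB)
      (\sum_(x : H) #|targets B x| + r * #|B|))).
    apply: leq_sum => B _; apply: leq_trans (size_pieces B) _; rewrite leq_add2r.
    by rewrite [X in _ <= X](bigID (mem B)) leq_addr.
  rewrite big_split /= leq_add2r exchange_big /= mulnC -sum_nat_const.
  apply: leq_sum => x _; apply: leq_trans (back_small x).
  rewrite -sum1_card [X in _ <= X](bigID (fun y => adj x y)) /=.
  apply: leq_trans (leq_addr _ _).
  rewrite (partition_big (piece x) (mem BB)) /= => [|y /andP[_ /pieceP[]]//].
  apply: leq_sum => B _; rewrite sum1dep_card; apply: subset_leq_card.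
  by apply/subsetP => y; rewrite !inE andbA.
rewrite mulnDr !(mulnCA r 4).
by set a := r * \sum_(B in BB) _; set b := r * \sum_(_ in _) _; lia.
Qed.

Lemma dense_graph_minor : has_minor G H.
Proof.
have [W [W_large W_linked]] := exists_linked_set G_gt0 dense.
have /card_gt0P[v0 _] := G_gt0.
have [|h [hW h_inj]] := @distinct_representatives H G v0 setT (fun=> W).
  move=> x _; rewrite cardsT -[#|H|]/v; move: total_room W_large; rewrite -[#|G|]/n.
  by lia.
have {}hW x : h x \in W by rewrite hW ?inE.
have {}h_inj : injective h by move=> x y; apply: h_inj.
(* Induction over the parts, starting from the hubs as singleton branch sets; the bound on the
   occupied vertices keeps room for the next part. *)
suff embed l : {subset l <= BB} ->
    200 * (v + \sum_(B <- l) (4 * #|B| + 4 * size (pieces B))) <= n ->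
    exists br, [/\ rooted_family h br,
      #|occupied br| <= v + \sum_(B <- l) (4 * #|B| + 4 * size (pieces B)) &
      forall B x y, B \in l -> y \in targets B x -> joined br x y].
  have [B|br [[br_con _ br_disj] _ br_join]] := embed (enum BB) _ total_room.
    by rewrite mem_enum.
  have join x y : adj x y -> y \in back x -> joined br x y.
    move=> xy yx; have [BBB _ _] := pieceP xy; apply: (br_join (piece x y)).
      by rewrite mem_enum.
    by rewrite inE yx xy eqxx.
  exists br; split=> // x y xy; case: (back_cover xy) => [|xy']; first exact: join.
  have [|u [w [uy wx uw]]] := join y x _ xy'; first by rewrite adj_sym.
  by exists w, u; split=> //; rewrite adj_sym.
elim: l => [|B l IHl] sub; rewrite ?big_nil ?big_cons => room.
  exists (fun x => [set h x]); split=> //.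
    split=> [x|x|x y xy]; rewrite ?set11 //; first exact: connected_set1.
    by rewrite disjoints1 inE (inj_eq h_inj).
  rewrite addn0; apply: leq_trans (card_bigcup_le _ _) _.
  by rewrite (eq_bigr _ (fun x _ => cards1 _)) sum1_card.
have [D lD||br [br_ok le_br br_join]] := IHl.
- by apply: sub; rewrite inE lD orbT.
- by lia.
have BBB : B \in BB by apply: sub; rewrite mem_head.
(* The positions in the list [pieces B] serve as the finite index type for [embed_piece]. *)
pose at_ := tnth (in_tuple (pieces B)).
have piece_mem e : exists x c,
    [/\ x \in B, c \in chunks r (targets B x) & at_ e = (x, x |: c)].
  have /allpairsPdep[x [c [xB cE eE]]] := mem_tnth e (in_tuple (pieces B)).
  by exists x, c; split; rewrite // -mem_enum.
have [e|e|e|||br' [br'_ok sub' le_br' br'_join]] := embed_piece W_linked hW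
  (center := fun e => (at_ e).1) (chunk := fun e => (at_ e).2) (B := B) (r := r)
  (Q := #|B| + size (pieces B)) G_gt0 dense W_large r_gt0 _ _ _ _ (piece_room BBB) br_ok.
- have [x [c [_ cE ->]]] := piece_mem e; apply: leq_trans (leq_card_setU _ _).1 _.
  by rewrite cards1 add1n ltnS; apply: card_chunks cE.
- have [x [c [xB cE ->]]] := piece_mem e; apply/subsetP => y /setU1P[->//|yc].
  by have [] := @targets_in B x y; rewrite ?(chunks_sub cE).
- by have [x [c [_ _ ->]]] := piece_mem e; rewrite setU11.
- by rewrite card_ord.
- by rewrite card_ord; lia.
exists br'; split=> // [|D x y].
  by rewrite card_ord in le_br'; lia.
rewrite inE => /orP[/eqP->|DL] yD; last exact: joined_sub sub' (br_join D x y DL yD).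
have [c cE yc] := mem_chunks r_gt0 yD; have [xB _] := targets_in yD.
have /tnthP[e eE] : (x, x |: c) \in in_tuple (pieces B).
  by apply/allpairsPdep; exists x, c; rewrite mem_enum.
have atE : at_ e = (x, x |: c) by rewrite /at_ -eE.
have := br'_join e y; rewrite atE /=; apply; first by rewrite inE yc orbT.
by apply: contraTneq yD => ->; rewrite inE adj_irrefl andbF.
Qed.

End Assembly.

Lemma sparse_minor (G H : sgraph) (BB : {set {set H}}) (d C m r D : nat) :
    degenerate d H -> bounded_decomposition C BB -> 0 < num_vertices H ->
    \sum_(B in BB) #|B| <= num_vertices H + m ->
    0 < r -> r * 4 ^ r * C <= 4 * num_vertices H ->
    0 < num_vertices G -> D * num_vertices G <= num_edges G ->
    1800 * (r * (num_vertices H + m) + d * num_vertices H) <= r * D ->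
  has_minor G H.
Proof.
move=> degH BB_dec v_gt0 leX r_gt0 le_C G_gt0 G_dense le_D.
have [back [back_small back_cover]] := degenerate_orientation degH.
(* A lower bound on the order n of the dense minor turns n <= 2 deg + 1 into n <= 3 deg. *)
have D_big : 1800 <= D.
  rewrite -(leq_pmul2l r_gt0); apply: leq_trans le_D; rewrite mulnC leq_mul2l /=.
  by apply: leq_trans (leq_addr _ _); rewrite leq_pmulr // addn_gt0 v_gt0.
have [|| G1 [min1 le1 deg1]] := @dense_neighborhood_minor G D G_gt0.
- by lia.
- rewrite -mulnA; apply: leq_trans (num_edges_sum_degree G).
  by rewrite leq_mul2l.
apply: has_minor_trans min1 _; rewrite -[#|G1|]/(num_vertices G1) in le1.
have le_rD := leq_mul (leqnn r) le1.
apply: (dense_graph_minor _ _ back_small back_cover BB_dec r_gt0).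
- by lia.
- by move=> y; have := deg1 y; rewrite -[#|G1|]/(num_vertices G1); lia.
(* The constant 1800 is 200 * (1 + 8), the coefficient of rv. The other room condition needs only
   180 * 4 * (d + 2r)v, by [le_C]. *)
- apply: leq_trans le_rD; apply: leq_trans le_D.
  have := leq_mul (leqnn r) leX; rewrite !mulnDr.
  by move: (r * _) (r * _) (r * _) (d * _) => a b c e; lia.
- rewrite -(leq_pmul2l r_gt0); apply: leq_trans le_rD; apply: leq_trans le_D.
  have := leq_mul le_C (leqnn (d + 2 * r)); rewrite !mulnDr.
  move: (4 ^ r) => p; nia.
Qed.

(* Imported only here, as it shadows the finite-set names set0, setT, etc. *)
From mathcomp Require Import all_classical all_reals all_analysis.
Import Order.TTheory GRing.Theory Num.Theory.
Local Open Scope ring_scope.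

(** * Choice of the chunk size and of the absolute constant *)

Lemma exists_chunk_size (R : realType) (v C : nat) : (0 < C < v)%N ->
  exists r : nat, [/\ (0 < r)%N, (r * 4 ^ r * C <= 4 * v)%N &
    ln (v%:R / C%:R) <= 6 * r%:R :> R].
Proof.
move=> /andP[C_gt0 Cv]; set L : R := ln _.
have C_gt0' : 0 < C%:R :> R by rewrite ltr0n.
have L_gt0 : 0 < L by rewrite ln_gt0 // ltr_pdivlMr // mul1r ltr_nat.
have truncL : (Num.trunc (L / 3))%:R <= L / 3 < (Num.trunc (L / 3)).+1%:R.
  by apply: truncn_itv; rewrite divr_ge0 // ltW.
(* The chunk size is the integer part of L/3, or 1 if that is zero; the factor 4 in [4 * v] serves
   the latter case. *)
set t := Num.trunc (L / 3) in truncL; have [t0|t_gt0] := posnP t.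
  exists 1%N; split=> //; first by rewrite expn1 mul1n leq_mul2l ltnW.
  by move: truncL; rewrite t0 => /andP[_]; rewrite !mulr1n; clearbody L; lra.
case/andP: truncL => le_t lt_t; exists t; split=> //; last first.
  move: lt_t; rewrite -[t.+1%:R]natr1; have : 1 <= t%:R :> R by rewrite ler1n.
  by lra.
apply: leq_trans (leq_pmull v (isT : 0 < 4)%N).
rewrite -(ler_nat R) natrM -ler_pdivlMr //.
have -> : v%:R / C%:R = expR L.
  by rewrite lnK // posrE divr_gt0 // ltr0n; apply: leq_trans Cv.
have e_ge2 : 2 <= expR 1 :> R by have := expR_ge1Dx (1 : R); lra.
(* The chain is t 4^t <= 8^t <= e^(3t) <= e^L = v/C. *)
apply: (@le_trans _ _ (expR 1 ^+ (3 * t))); last first.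
  by rewrite -expRM_natl mulr1 ler_expR natrM; lra.
apply: (@le_trans _ _ (2 ^+ (3 * t))); last by rewrite lerXn2r // nnegrE; lra.
rewrite -natrX ler_nat expnM -[(2 ^ 3)%N]/(2 * 4)%N expnMn leq_mul2r.
by rewrite ltnW ?orbT // ltn_expl.
Qed.

Theorem theorem9p7 (R : realType) :
  exists K : R,
    forall (Delta m C : nat), (3 <= Delta)%N -> (Delta ^ 2 <= C)%N ->
    forall H : sgraph, degenerate Delta H -> (C < num_vertices H)%N ->
    forall BB : {set {set H}},
      bounded_decomposition C BB -> excess BB <= m%:Z ->
    (minor_density R H <=
      (K * ((num_vertices H)%:R + m%:R
            + Delta%:R * (num_vertices H)%:R
              / ln ((num_vertices H)%:R / C%:R)))%:E)%E.
Proof.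
(* Since dv <= 6r(dv/L), the condition of [sparse_minor] needs 1800 * 6 = 10800 on the last term.
   The surplus in the coefficient of v absorbs the rounding of the density down to the integer
   [D]. *)
exists 12000 => d m C d_ge3 le_C H degH Cv BB BB_dec; rewrite /excess => le_excess.
have C_gt0 : (0 < C)%N by apply: leq_trans le_C; rewrite expn_gt0; lia.
have v_gt0 : (0 < num_vertices H)%N by apply: leq_trans Cv.
have {}le_excess : (\sum_(B in BB) #|B| <= num_vertices H + m)%N.
  by move: le_excess; rewrite lerBlDl -PoszD.
have [|r [r_gt0 r_C r_ln]] := @exists_chunk_size R (num_vertices H) C.
  by rewrite C_gt0.
have L_gt0 : 0 < ln ((num_vertices H)%:R / C%:R) :> R.
  by rewrite ln_gt0 // ltr_pdivlMr ?ltr0n // mul1r ltr_nat.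
set L := ln _ in r_ln L_gt0 *.
apply: ge_ereal_sup => _ [G [G_gt0 no_minor ->]]; rewrite lee_fin leNgt.
apply/negP => dense; apply: no_minor.
have vG_gt0 : 0 < (num_vertices G)%:R :> R by rewrite ltr0n.
pose D := (num_edges G %/ num_vertices G)%N.
have lt_D : (num_edges G)%:R / (num_vertices G)%:R < D%:R + 1 :> R.
  by rewrite ltr_pdivrMr // natr1 -natrM ltr_nat ltn_ceil.
apply: (@sparse_minor G H BB d C m r D) => //; first exact: leq_trunc_div.
have r_ge1 : 1 <= r%:R :> R by rewrite ler1n.
have v_ge1 : 1 <= (num_vertices H)%:R :> R by rewrite ler1n.
have L_r : d%:R * (num_vertices H)%:R <= 6 * (r%:R * (d%:R * (num_vertices H)%:R / L)) :> R.
  rewrite mulrA mulrA ler_pdivlMr // mulrC ler_wpM2r // mulr_ge0 //.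
rewrite -(ler_nat R) !natrM natrD !natrM natrD.
have := lt_trans dense lt_D; set q := d%:R * _ / L in L_r *; set w := d%:R * _ in L_r *.
move=> /ltW lt_D'; have r_ge0 : 0 <= r%:R :> R by [].
have := ler_wpM2l r_ge0 lt_D'; have := ler_wpM2l r_ge0 v_ge1.
have : 0 <= r%:R * m%:R :> R by rewrite mulr_ge0.
have : 0 <= w by rewrite mulr_ge0.
by clearbody q w; lra.
Qed.
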